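(* Let $\mathcal{C}$ be a small poset-enriched category, $\Sigma$ a collection of morphisms in $\mathcal{C}$, and $F,G,H:\mathcal{C}\to\mathbf{Pos}$ enriched functors such that $GA$ is complete for every object $A$ and $Gf$ preserves all meets and joins for all $f\in\Sigma$. Let $\iota:F\to H$ be a strict transformation. Suppose that for every $f:A\to B$ in $\Sigma$ the maps $Ff:FA\to FB$ and $Hf:HA\to HB$ have left adjoints $(Ff)_*:FB\to FA$ and $(Hf)_*:HB\to HA$ such that $\iota_A\circ(Ff)_*=(Hf)_*\circ\iota_B$. Then left extensions of $\Sigma$-natural transformations along $\iota$ are objectwise: for every $\Sigma$-natural transformation $\tau:F\to G$, the left extension $\mathrm{Lan}_\iota\tau$ satisfies $(\mathrm{Lan}_\iota\tau)_A=\mathrm{Lan}_{\iota_A}\tau_A$ for every object $A$ of $\mathcal{C}$.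
   Context: $\mathbf{Pos}$ is the category of posets and order-preserving maps, enriched over itself. A $\Sigma$-natural (general) transformation $\tau:F\to G$ is a family of order-preserving maps $(\tau_A:FA\to GA)_A$ with $Gf\circ\tau_A=\tau_B\circ Ff$ for all $f:A\to B$ in $\Sigma$ (no condition for other morphisms); it is strict if this holds for all morphisms $f$ of $\mathcal{C}$. Transformations are ordered pointwise. The left extension of a $\Sigma$-natural transformation $\tau:F\to G$ along $\iota:F\to H$ is the $\Sigma$-natural transformation $\mathrm{Lan}_\iota\tau:H\to G$ such that $\mathrm{Lan}_\iota\tau\circ\iota\ge\tau$ and every $\Sigma$-natural $\tau':H\to G$ with $\tau'\circ\iota\ge\tau$ satisfies $\tau'\ge\mathrm{Lan}_\iota\tau$ (it exists under the stated assumptions on $G$). $\mathrm{Lan}_{\iota_A}\tau_A:HA\to GA$ is the left Kan extension of order-preserving maps, $\mathrm{Lan}_{\iota_A}\tau_A(x)=\bigvee\{\tau_A(y)\mid y\in FA,\ \iota_A(y)\le x\}$. *)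

(* Defs.v *)
From HB Require Import structures.
From mathcomp Require Import all_boot all_order.
From mathcomp Require Import boolp classical_sets.

Set Implicit Arguments.
Unset Strict Implicit.
Unset Printing Implicit Defensive.

Import Order.TTheory.
Local Open Scope classical_set_scope.
Local Open Scope order_scope.

(* The displays carried by the ordered types below have no mathematical
   content: every poset can be given any display. *)

Record posCategory (d : Order.disp_t) := PosCategory {
  obj :> Type;
  hom : obj -> obj -> porderType d;
  idm : forall A, hom A A;
  compm : forall A B D, hom B D -> hom A B -> hom A D;
  comp_idl : forall A B (f : hom A B), compm (idm B) f = f;
  comp_idr : forall A B (f : hom A B), compm f (idm A) = f;
  comp_assoc : forall A B D E (h : hom D E) (g : hom B D) (f : hom A B),
    compm h (compm g f) = compm (compm h g) f;
  comp_le : forall A B D (g g' : hom B D) (f f' : hom A B),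
    g <= g' -> f <= f' -> compm g f <= compm g' f'
}.
Arguments hom {d p}.
Arguments idm {d p}.
Arguments compm {d p A B D}.

(* Order-enriched functors from C to the category of posets, whose hom-posets
   are ordered pointwise. *)
Record posFunctor (dC : Order.disp_t) (C : posCategory dC) (d : Order.disp_t) :=
  PosFunctor {
  fobj :> C -> porderType d;
  fmap : forall A B : C, hom A B -> {omorphism fobj A -> fobj B};
  fmap_id : forall A, fmap (idm A) =1 id;
  fmap_comp : forall A B D (g : hom B D) (f : hom A B),
    fmap (compm g f) =1 fmap g \o fmap f;
  fmap_le : forall A B (f f' : hom A B), f <= f' ->
    forall x, fmap f x <= fmap f' x
}.
Arguments fmap {dC C d} p {A B}.

Definition morphisms (dC : Order.disp_t) (C : posCategory dC) :=
  forall A B : C, set (hom A B).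

Section Posets.
Context {d d' : Order.disp_t}.

Definition complete (P : porderType d) : Prop :=
  forall S : set P, supremums S !=set0 /\ infimums S !=set0.

(* The library's [supremum] returns a default value on the empty set, so it is
   not the join of a complete poset. *)
Definition join (P : porderType d) (cP : complete P) (S : set P) : P :=
  projT1 (cid (cP S).1).

Lemma joinP (P : porderType d) (cP : complete P) (S : set P) :
  supremums S (join cP S).
Proof. exact: projT2 (cid (cP S).1). Qed.

Definition preserves_joins (P : porderType d) (Q : porderType d') (g : P -> Q) :=
  forall (S : set P) (m : P), supremums S m -> supremums (g @` S) (g m).

Definition preserves_meets (P : porderType d) (Q : porderType d') (g : P -> Q) :=
  forall (S : set P) (m : P), infimums S m -> infimums (g @` S) (g m).

Definition left_adjoint (P : porderType d) (Q : porderType d')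
    (l : {omorphism Q -> P}) (r : {omorphism P -> Q}) : Prop :=
  forall (y : Q) (x : P), (l y <= x) = (y <= r x).

End Posets.

Definition lan (dX dY dZ : Order.disp_t) (X : porderType dX) (Y : porderType dY)
    (Z : porderType dZ) (cY : complete Y) (i : {omorphism X -> Z})
    (t : {omorphism X -> Y}) (z : Z) : Y :=
  join cY [set t x | x in [set x | i x <= z]].

Section Transformations.
Context {dC : Order.disp_t} {C : posCategory dC}.

Definition transf {d d' : Order.disp_t} (F : posFunctor C d)
    (G : posFunctor C d') :=
  forall A : C, {omorphism F A -> G A}.

Definition natural_on (Sigma : morphisms C) {d d' : Order.disp_t}
    (F : posFunctor C d) (G : posFunctor C d') (tau : transf F G) : Prop :=
  forall (A B : C) (f : hom A B), Sigma A B f ->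
    fmap G f \o tau A =1 tau B \o fmap F f.

Definition strict {d d' : Order.disp_t}
    (F : posFunctor C d) (G : posFunctor C d') (tau : transf F G) : Prop :=
  natural_on (fun A B => setT) tau.

Definition left_extension (Sigma : morphisms C) {dF dG dH : Order.disp_t}
    (F : posFunctor C dF) (G : posFunctor C dG) (H : posFunctor C dH)
    (iota : transf F H) (tau : transf F G) (L : transf H G) : Prop :=
  [/\ natural_on Sigma L,
      forall (A : C) (x : F A), tau A x <= L A (iota A x)
    & forall L' : transf H G, natural_on Sigma L' ->
        (forall (A : C) (x : F A), tau A x <= L' A (iota A x)) ->
        forall (A : C) (z : H A), L A z <= L' A z].

End Transformations.

(* Main.v *)
(* Each objectwise extension is pointwise below every competitor, so everything
   reduces to its Sigma-naturality, that is to Gf (Lan z) = Lan (Hf z) for f in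
   Sigma. The map Gf moves inside the join, and {tau (Ff y) | iota y <= z} is
   cofinal in {tau y' | iota y' <= Hf z}: an element y' of the latter family is
   dominated by y = (Ff)_* y', since iota y = (Hf)_* (iota y') <= z and
   y' <= Ff y. *)

From HB Require Import structures.
From mathcomp Require Import all_boot all_order.
From mathcomp Require Import boolp classical_sets.
Require Import Defs.

Set Implicit Arguments.
Unset Strict Implicit.
Unset Printing Implicit Defensive.

Import Order.TTheory.
Local Open Scope classical_set_scope.
Local Open Scope order_scope.

Section Lan.
Context {dX dY dZ : Order.disp_t}.
Context {X : porderType dX} {Y : porderType dY} {Z : porderType dZ}.
Context (cY : complete Y) (i : {omorphism X -> Z}) (t : {omorphism X -> Y}).

Lemma le_lan x z : i x <= z -> t x <= lan cY i t z.
Proof. by move=> ixz; apply: (joinP _ _).1; exists x. Qed.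

Lemma lan_le z y : (forall x, i x <= z -> t x <= y) -> lan cY i t z <= y.
Proof. by move=> ty; apply: (joinP _ _).2 => _ [x /= ixz <-]; exact: ty. Qed.

Lemma lan_nondecreasing : {homo lan cY i t : z z' / z <= z'}.
Proof.
by move=> z z' zz'; apply: lan_le => x ixz; apply/le_lan/(le_trans ixz).
Qed.

HB.instance Definition _ :=
  Order.isOrderMorphism.Build dZ Z dY Y (lan cY i t) lan_nondecreasing.

Definition lan_omorphism : {omorphism Z -> Y} := lan cY i t.

End Lan.

Section LanTransf.
Context {dC dF dG dH : Order.disp_t} {C : posCategory dC}.
Context (Sigma : morphisms C).
Context {F : posFunctor C dF} {G : posFunctor C dG} {H : posFunctor C dH}.
Context (cG : forall A : C, complete (G A)).
Context (iota : transf F H) (tau : transf F G).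

Definition lan_transf : transf H G :=
  fun A => lan_omorphism (@cG A) (iota A) (tau A).

Lemma lan_transf_natural :
  (forall (A B : C) (f : hom A B), Sigma f -> preserves_joins (fmap G f)) ->
  natural_on Sigma iota ->
  (forall (A B : C) (f : hom A B), Sigma f ->
     exists (Fl : {omorphism F B -> F A}) (Hl : {omorphism H B -> H A}),
       [/\ left_adjoint Fl (fmap F f),
           left_adjoint Hl (fmap H f)
         & iota A \o Fl =1 Hl \o iota B]) ->
  natural_on Sigma tau -> natural_on Sigma lan_transf.
Proof.
move=> Gjoins iota_nat adj tau_nat A B f Sf z /=.
have [Fl [Hl [adjF adjH iotal]]] := adj _ _ _ Sf.
(* [fmap G f] sends the join defining the extension at [z] to a supremum of the image family; [ub]
   and [lub] are its two halves, one for each inequality. *)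
have [ub lub] := Gjoins _ _ _ Sf _ _
  (joinP (@cG A) [set tau A x | x in [set x | iota A x <= z]]).
apply/eqP; rewrite eq_le; apply/andP; split.
  (* Both naturality squares apply: the term is [tau B (fmap F f y)], and [iota B (fmap F f y)]
     equals [fmap H f (iota A y)], which lies below [fmap H f z]. *)
  apply: lub => _ [_ [y /= iyz <-] <-].
  have /= -> := tau_nat _ _ _ Sf y.
  apply: le_lan; have /= <- := iota_nat _ _ _ Sf y.
  exact: omorph_le.
apply: lan_le => y iyz.
(* The unit of the adjunction, transposed from [Fl y <= Fl y]. *)
have yFl : y <= fmap F f (Fl y) by rewrite -adjF.
apply: le_trans (omorph_le (tau B) yFl) _.
have /= <- := tau_nat _ _ _ Sf (Fl y).
(* It remains to see that [Fl y] indexes the join at [z], i.e. [iota A (Fl y) <= z]; this transposes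
   to [iyz] once [iota] is moved past the left adjoints. *)
apply/ub/imageP/imageP => /=.
by have /= -> := iotal y; rewrite adjH.
Qed.

(** Minimality is checked objectwise: if [iota A x <= z], monotonicity of a competitor [L'] gives
    [tau A x <= L' A (iota A x) <= L' A z]. *)
Lemma lan_transf_left_extension :
  natural_on Sigma lan_transf -> left_extension Sigma iota tau lan_transf.
Proof.
split=> // [A x|L' _ tauL' A z]; first exact: le_lan.
apply: lan_le => x ixz.
exact: le_trans (tauL' A x) (omorph_le (L' A) ixz).
Qed.

(** Each of the two is a competitor for the other, so antisymmetry applies. This carries the formula
    from [lan_transf] to an arbitrary left extension. *)
Lemma left_extension_unique (L L' : transf H G) :
  left_extension Sigma iota tau L -> left_extension Sigma iota tau L' ->
  forall A, L A =1 L' A.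
Proof.
move=> [Lnat Lext Lmin] [L'nat L'ext L'min] A z.
by apply/eqP; rewrite eq_le Lmin // L'min.
Qed.

End LanTransf.

Theorem theorem5p1 (dC dF dG dH : Order.disp_t) (C : posCategory dC)
    (Sigma : morphisms C)
    (F : posFunctor C dF) (G : posFunctor C dG) (H : posFunctor C dH)
    (cG : forall A : C, complete (G A))
    (Gjoins : forall (A B : C) (f : hom A B), Sigma A B f ->
       preserves_joins (fmap G f))
    (Gmeets : forall (A B : C) (f : hom A B), Sigma A B f ->
       preserves_meets (fmap G f))
    (iota : transf F H) (iota_strict : strict iota)
    (adj : forall (A B : C) (f : hom A B), Sigma A B f ->
       exists (Fl : {omorphism F B -> F A}) (Hl : {omorphism H B -> H A}),
         [/\ left_adjoint Fl (fmap F f),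
             left_adjoint Hl (fmap H f)
           & iota A \o Fl =1 Hl \o iota B])
    (tau : transf F G) (tau_natural : natural_on Sigma tau) :
  (exists L : transf H G, left_extension Sigma iota tau L) /\
  (forall L : transf H G, left_extension Sigma iota tau L ->
     forall A : C, L A =1 lan (cG A) (iota A) (tau A)).
Proof.
have lan_ext : left_extension Sigma iota tau (lan_transf cG iota tau).
  apply: lan_transf_left_extension; apply: lan_transf_natural => //.
  by move=> A B f _; exact: iota_strict.
split; first by exists (lan_transf cG iota tau).
by move=> L L_ext; exact: left_extension_unique L_ext lan_ext.
Qed.
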